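(* Let $a,b\in\mathbb{Z}$ with $a<b$, let $n\ge 1$ be an integer, and let $f$ be a real function that is $C^n$ on $[a,b]$. Let $m,p\ge 0$ be integers with $m\le b-a$, and put $a'=a+m$. Then $$\sum_{i=a}^{b}f(i)=\sum_{i=a}^{a'-1}f(i)+\int_{a'}^{b}\frac{\sin((2p+1)\pi x)}{\sin(\pi x)}f(x)\,dx+\frac{f(a')+f(b)}{2}+\sum_{r=1}^{\lfloor n/2\rfloor}(-1)^{r}\,T_{2r,p}\,M_{2r-1}(a',b)+R_{mnp},$$ where the remainder term is $$R_{mnp}=(-1)^{n}\int_{a'}^{b}\sum_{|k|>p}\frac{e^{2\pi i kx}}{(2\pi i k)^{n}}\,f^{(n)}(x)\,dx.$$
   Context: For integers $s\ge 2$ and $p\ge 0$, $T_{s,p}=\frac{2}{(2\pi)^{s}}\left(\zeta(s)-\sum_{k=1}^{p}\frac{1}{k^{s}}\right)$, where $\zeta$ is the Riemann zeta function. For an integer $\nu\ge 0$, $M_\nu(a',b)=f^{(\nu)}(a')-f^{(\nu)}(b)$. In the exponentials $i$ is the imaginary unit; the sum over $|k|>p$ runs over $k\in\mathbb{Z}$ and for $n=1$ is understood as the symmetric limit $\lim_{K\to\infty}\sum_{p<|k|\le K}$. The kernel $\sin((2p+1)\pi x)/\sin(\pi x)=\sum_{k=-p}^{p}e^{2\pi i kx}$ is extended by continuity to integers $x$ (value $2p+1$). Empty sums are $0$. *)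

(* Defs.v *)
From Stdlib Require Export Reals ZArith.
From Coquelicot Require Export Coquelicot.

Open Scope R_scope.

(* Sum over the integers lo <= k <= hi, equal to zero when hi < lo. *)
Definition Zsum {G : AbelianMonoid} (u : Z -> G) (lo hi : Z) : G :=
  sum_n_m (fun j : nat => u (lo + Z.of_nat j - 1)%Z) 1 (Z.to_nat (hi - lo + 1)).

Definition Icc (a b : R) (x : R) : Prop := a <= x <= b.

(* The difference quotient is only taken at points of D, so that on D = [a,b]
   the derivative is one-sided at the endpoints and values of f outside [a,b]
   are irrelevant. *)
Definition is_derive_on (D : R -> Prop) (f : R -> R) (x l : R) : Prop :=
  filterlim (fun y => (f y - f x) / (y - x)) (within D (locally' x)) (locally l).

Definition derive_on (D : R -> Prop) (f : R -> R) (x : R) : R :=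
  iota (is_derive_on D f x).

Fixpoint derive_n_on (D : R -> Prop) (f : R -> R) (n : nat) : R -> R :=
  match n with
  | O => f
  | S k => derive_on D (derive_n_on D f k)
  end.

(* Continuity of the derivatives of order less than n follows from their
   differentiability. *)
Definition Cn_on (n : nat) (D : R -> Prop) (f : R -> R) : Prop :=
  (forall k : nat, (k < n)%nat -> forall x : R, D x ->
     exists l : R, is_derive_on D (derive_n_on D f k) x l) /\
  continuous_on D (derive_n_on D f n).

(* Riemann zeta at an integer s >= 2, where the Dirichlet series converges. *)
Definition zeta (s : nat) : R := Series (fun k : nat => / INR (S k) ^ s).

Definition T (s p : nat) : R :=
  2 / (2 * PI) ^ s * (zeta s - sum_n_m (fun k : nat => / INR k ^ s) 1 p).

Definition M (D : R -> Prop) (f : R -> R) (nu : nat) (a' b : R) : R :=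
  derive_n_on D f nu a' - derive_n_on D f nu b.

(* frac_part x = 0 means that x is an integer. *)
Definition dirichlet_kernel (p : nat) (x : R) : R :=
  if Req_EM_T (frac_part x) 0 then 2 * INR p + 1
  else sin ((2 * INR p + 1) * PI * x) / sin (PI * x).

Definition Cexp (z : C) : C := (exp (Re z) * cos (Im z), exp (Re z) * sin (Im z)).

Definition fourier_tail_term (n : nat) (x : R) (k : Z) : C :=
  (Cexp (2 * PI * Ci * IZR k * x) / (2 * PI * Ci * IZR k) ^ n)%C.

(* The symmetric limit of the sums over p < |k| <= K as K tends to infinity.
   For n >= 2 the series over |k| > p converges absolutely and this is its sum;
   for n = 1 the order of summation matters. *)
Definition fourier_tail (n p : nat) (x : R) : C :=
  @iota C_R_CompleteNormedModule (fun l : C =>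
    filterlim
      (fun K : nat =>
         Zsum (fun k : Z => if (Z.of_nat p <? Z.abs k)%Z
                            then fourier_tail_term n x k else RtoC 0)
              (- Z.of_nat K) (Z.of_nat K))
      eventually (locally l)).

Definition remainder (D : R -> Prop) (f : R -> R) (n p : nat) (a' b : R) : C :=
  ((-1) ^ n * @RInt C_R_CompleteNormedModule
     (fun x => fourier_tail n p x * RtoC (derive_n_on D f n x)) a' b)%C.

(* Main.v *)
Require Import Defs.
From Stdlib Require Import Reals ZArith Lia Lra.
From Coquelicot Require Import Coquelicot.

(* Pairing k with -k, the kernel of the remainder is the tail of the real
   series bern n = sum_k 2 cos(2 pi k x - n pi/2) / (2 pi k)^n, a periodic
   Bernoulli function up to a factor: bern 1 is the sawtooth 1/2 - x on (0,1),
   and (bern (n+1))' = bern n off the integers. On a unit interval, bern 1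
   minus its partial sum of order p is a primitive of minus the Dirichlet kernel,
   so one integration by parts gives the case n = 1. Each further integration
   by parts raises n by one; by periodicity the boundary terms telescope to
   the value of the tail of bern (n+1) at 0, which is (-1)^r T_(2r,p) for
   n+1 = 2r and 0 for n+1 odd. *)

(** * Periodic Bernoulli functions as trigonometric series *)

(** The delicate order is n = 1. There the series converges only conditionally and its sum jumps at
    the integers, so convergence cannot be uniform on a whole unit interval. An explicit rate on
    [d, 1 - d] replaces it: local uniformity suffices to differentiate the series of order 2 term by
    term inside (0,1). For n >= 2 a bound independent of x does everything. For the same reason
    every integral is cut at the integers, with primitives required to be continuous there but
    differentiable only in between. The phase -n pi/2 is the argument of 1/i^n; keeping it inside
    the cosine gives one formula for all n, so that parity matters only in the values at 0. *)

(* The sum of the terms of index k and -k of the Fourier series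
   sum e^(2 pi i k x) / (2 pi i k)^n. *)
Definition bern_term (n k : nat) (x : R) : R :=
  2 * cos (2 * PI * INR k * x - INR n * (PI / 2)) / (2 * PI * INR k) ^ n.

Definition bern_sum (n K : nat) (x : R) : R :=
  sum_n_m (fun k => bern_term n k x) 1 K.

(** [Lim_seq] is total, so periodicity follows by extensionality before any convergence is known;
    [is_lim_bern_sum] later shows that for n >= 1 this is a genuine limit. *)
Definition bern (n : nat) (x : R) : R := real (Lim_seq (fun K => bern_sum n K x)).

Lemma sum_1_0 (u : nat -> R) : sum_n_m u 1 0 = 0.
Proof. exact (sum_n_m_zero u 1 0 (Nat.lt_0_succ 0)). Qed.

Lemma sum_1_S (u : nat -> R) (K : nat) :
  sum_n_m u 1 (S K) = sum_n_m u 1 K + u (S K).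
Proof. apply (sum_n_Sm u). lia. Qed.

Lemma PI_INR_pos (k : nat) : (0 < k)%nat -> 0 < 2 * PI * INR k.
Proof. intros hk. apply lt_0_INR in hk. pose proof PI_RGT_0. nra. Qed.

(** Differentiating a cosine advances its phase by pi/2, which is exactly the change from S n to n;
    the factor 2 pi k cancels one power of the denominator. *)
Lemma is_derive_bern_term (n k : nat) (x : R) :
  (0 < k)%nat -> is_derive (bern_term (S n) k) x (bern_term n k x).
Proof.
  intros hk. pose proof (PI_INR_pos k hk) as hp. unfold bern_term.
  assert (hn : (2 * PI * INR k) ^ n <> 0) by (apply pow_nonzero; lra).
  auto_derive; [exact I|].
  change (match n with O => 1 | S _ => INR n + 1 end) with (INR (S n)).
  replace (2 * PI * INR k * x + - (INR (S n) * (PI / 2)))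
    with (- (PI / 2 - (2 * PI * INR k * x - INR n * (PI / 2))))
    by (rewrite S_INR; field).
  rewrite sin_neg, sin_shift. simpl pow. field. split; [exact hn|].
  split; [|pose proof PI_RGT_0; lra]. apply not_0_INR. lia.
Qed.

Lemma is_derive_bern_sum (n K : nat) (x : R) :
  is_derive (bern_sum (S n) K) x (bern_sum n K x).
Proof.
  induction K as [|K IH].
  - unfold bern_sum. rewrite sum_1_0.
    apply (is_derive_ext (fun _ => 0)); [intros t; now rewrite sum_1_0|].
    apply is_derive_Reals, derivable_pt_lim_const.
  - unfold bern_sum in *. rewrite sum_1_S.
    apply (is_derive_ext (fun y => sum_n_m (fun k => bern_term (S n) k y) 1 K
                                   + bern_term (S n) (S K) y)).
    + intros t. now rewrite sum_1_S.
    + apply @is_derive_plus; [exact IH|].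
      apply is_derive_bern_term. lia.
Qed.

Lemma continuity_bern_term (n k : nat) (x : R) : continuity_pt (bern_term n k) x.
Proof. unfold bern_term. reg. Qed.

Lemma continuity_bern_sum (n K : nat) (x : R) : continuity_pt (bern_sum n K) x.
Proof.
  unfold bern_sum. induction K as [|K IH].
  - apply (continuity_pt_ext (fun _ => 0)); [intros t; now rewrite sum_1_0|].
    apply continuity_pt_const. intros ? ?. reflexivity.
  - apply (continuity_pt_ext (fun y => sum_n_m (fun k => bern_term n k y) 1 K
                                   + bern_term n (S K) y)).
    + intros t. now rewrite sum_1_S.
    + apply (continuity_pt_plus _ _ x IH). apply continuity_bern_term.
Qed.

Lemma bern_term_period (n k : nat) (x : R) : bern_term n k (x + 1) = bern_term n k x.
Proof.
  unfold bern_term.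
  replace (2 * PI * INR k * (x + 1) - INR n * (PI / 2))
    with ((2 * PI * INR k * x - INR n * (PI / 2)) + 2 * INR k * PI) by ring.
  now rewrite cos_period.
Qed.

Lemma bern_sum_period1 (n K : nat) (x : R) : bern_sum n K (x + 1) = bern_sum n K x.
Proof. apply sum_n_m_ext. intros k. apply bern_term_period. Qed.

Lemma Z_period {A : Type} (g : R -> A) :
  (forall x, g (x + 1) = g x) -> forall (z : Z) (x : R), g (x + IZR z) = g x.
Proof.
  intros h z. pattern z. apply Z.peano_ind.
  - intros x. now rewrite Rplus_0_r.
  - intros y IH x. rewrite succ_IZR, <- Rplus_assoc, h. apply IH.
  - intros y IH x. rewrite <- (h (x + IZR (Z.pred y))), <- (IH x).
    f_equal. rewrite <- Z.sub_1_r, minus_IZR. ring.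
Qed.

Lemma bern_sum_period (n K : nat) (z : Z) (x : R) :
  bern_sum n K (x + IZR z) = bern_sum n K x.
Proof. exact (Z_period _ (bern_sum_period1 n K) z x). Qed.

Lemma bern_period (n : nat) (z : Z) (x : R) : bern n (x + IZR z) = bern n x.
Proof.
  unfold bern. f_equal. apply Lim_seq_ext. intros K. apply bern_sum_period.
Qed.

Lemma bern_term_bound (n k : nat) (x : R) :
  (2 <= n)%nat -> (0 < k)%nat -> Rabs (bern_term n k x) <= / INR k ^ 2.
Proof.
  intros hn hk. unfold bern_term. pose proof (PI_INR_pos k hk) as hp.
  assert (h1 : 1 <= INR k) by (apply (le_INR 1); lia).
  assert (hpi : 2 <= PI) by (pose proof PI2_1; lra).
  assert (hw : 2 * INR k <= 2 * PI * INR k) by nra.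
  set (w := 2 * PI * INR k) in *.
  assert (hq : 2 * INR k ^ 2 <= w ^ n).
  { apply Rle_trans with (w ^ 2); [|apply Rle_pow; [lra|lia]].
    pose proof (Rmult_le_compat (2 * INR k) w (2 * INR k) w ltac:(lra) ltac:(lra) hw hw).
    rewrite <- !Rsqr_pow2. unfold Rsqr. nra. }
  assert (h2 : 0 < INR k ^ 2) by (apply pow_lt; lra).
  unfold Rdiv. rewrite Rabs_mult, Rabs_inv, (Rabs_right ((_) ^ n)) by nra.
  apply Rle_trans with (2 * / w ^ n).
  - apply Rmult_le_compat_r; [left; apply Rinv_0_lt_compat; nra|].
    rewrite Rabs_mult, (Rabs_right 2) by lra.
    enough (Rabs (cos (w * x - INR n * (PI * / 2))) <= 1) by lra.
    apply Rabs_le, COS_bound.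
  - apply Rle_trans with (2 * / (2 * INR k ^ 2)).
    + apply Rmult_le_compat_l; [lra|]. apply Rinv_le_contravar; lra.
    + right. field. lra.
Qed.

(** Since 1/(t+1)^2 <= 1/t - 1/(t+1), the bounds on the terms telescope. The result does not depend
    on x, which makes the convergence uniform on R. *)
Lemma bern_sum_cauchy (n K L : nat) (x : R) :
  (2 <= n)%nat -> (0 < K)%nat ->
  Rabs (bern_sum n (K + L) x - bern_sum n K x) <= / INR K - / INR (K + L).
Proof.
  intros hn hK. induction L as [|L IH].
  - rewrite Nat.add_0_r, !Rminus_diag, Rabs_R0. lra.
  - rewrite Nat.add_succ_r. unfold bern_sum in *. rewrite sum_1_S.
    assert (h1 : 1 <= INR (K + L)) by (apply (le_INR 1); lia).
    apply Rle_trans with (Rabs (sum_n_m (fun k => bern_term n k x) 1 (K + L)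
       - sum_n_m (fun k => bern_term n k x) 1 K) + Rabs (bern_term n (S (K + L)) x)).
    + eapply Rle_trans; [|apply Rabs_triang]. right. f_equal. ring.
    + pose proof (bern_term_bound n (S (K + L)) x hn ltac:(lia)) as hb.
      assert (/ INR (S (K + L)) ^ 2 <= / INR (K + L) - / INR (S (K + L))); [|lra].
      rewrite S_INR. set (t := INR (K + L)) in *.
      replace (/ t - / (t + 1)) with (/ (t * (t + 1))) by (field; lra).
      apply Rinv_le_contravar; nra.
Qed.

Lemma inv_INR_eventually (eps : R) :
  0 < eps -> exists N : nat, (0 < N)%nat /\
    forall K, (N <= K)%nat -> / INR K < eps.
Proof.
  intros he. destruct (archimed_cor1 eps he) as [N [h1 h2]].
  exists N. split; [exact h2|]. intros K hK.
  apply Rle_lt_trans with (/ INR N); [|exact h1].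
  apply Rinv_le_contravar; [now apply lt_0_INR|now apply le_INR].
Qed.

Lemma is_lim_bern_sum_ge2 (n : nat) (x : R) :
  (2 <= n)%nat -> is_lim_seq (fun K => bern_sum n K x) (bern n x).
Proof.
  intros hn. unfold bern. apply Lim_seq_correct', ex_lim_seq_cauchy_corr.
  intros eps. destruct (inv_INR_eventually (eps / 2)) as [N [hN h]];
    [destruct eps; simpl; lra|].
  assert (hc : forall K, (N <= K)%nat -> Rabs (bern_sum n K x - bern_sum n N x) < eps / 2).
  { intros K hK. replace K with (N + (K - N))%nat by lia.
    eapply Rle_lt_trans; [apply bern_sum_cauchy; lia|].
    pose proof (h N ltac:(lia)).
    assert (0 < / INR (N + (K - N))) by (apply Rinv_0_lt_compat, lt_0_INR; lia). lra. }
  exists N. intros K L hK hL.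
  pose proof (hc K hK) as h1. pose proof (hc L hL) as h2.
  apply Rabs_def2 in h1. apply Rabs_def2 in h2. apply Rabs_def1; lra.
Qed.

Lemma bern_sum_rate (n K : nat) (x : R) :
  (2 <= n)%nat -> (0 < K)%nat -> Rabs (bern n x - bern_sum n K x) <= / INR K.
Proof.
  intros hn hK.
  assert (hl : is_lim_seq (fun L => Rabs (bern_sum n (L + K) x - bern_sum n K x))
                 (Rabs (bern n x - bern_sum n K x))).
  { apply (is_lim_seq_abs _ (bern n x - bern_sum n K x)).
    apply is_lim_seq_minus'; [|apply is_lim_seq_const].
    apply (is_lim_seq_incr_n (fun L => bern_sum n L x)).
    now apply is_lim_bern_sum_ge2. }
  refine (is_lim_seq_le _ (fun _ => / INR K) _ (/ INR K) _ hl (is_lim_seq_const _)).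
  intros L. rewrite Nat.add_comm.
  eapply Rle_trans; [now apply bern_sum_cauchy|].
  assert (0 < / INR (K + L)) by (apply Rinv_0_lt_compat, lt_0_INR; lia). lra.
Qed.

(** * The Dirichlet kernel and the convergence of the sawtooth series *)

Lemma dirichlet_identity (K : nat) (x : R) :
  sin (PI * x) * (1 + bern_sum 0 K x) = sin ((2 * INR K + 1) * PI * x).
Proof.
  unfold bern_sum. induction K as [|K IH].
  - rewrite sum_1_0. simpl INR. rewrite Rplus_0_r, Rmult_1_r. f_equal. ring.
  - rewrite sum_1_S, <- Rplus_assoc, Rmult_plus_distr_l, IH.
    unfold bern_term. simpl pow. simpl (INR 0). rewrite S_INR.
    (* The step is sin(t + 2u) - sin t = 2 sin u cos(t + u) with u = pi x. Being multiplied by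
       sin(pi x), the identity needs no division and also holds at the integers. *)
    set (t := (2 * INR K + 1) * PI * x).
    replace (2 * PI * (INR K + 1) * x - 0 * (PI / 2)) with (t + PI * x) by (unfold t; ring).
    replace ((2 * (INR K + 1) + 1) * PI * x) with (t + 2 * (PI * x)) by (unfold t; ring).
    rewrite !cos_plus, sin_plus, sin_2a, cos_2a.
    pose proof (sin2_cos2 (PI * x)) as h. unfold Rsqr in h.
    replace (sin t) with (sin t * (sin (PI * x) * sin (PI * x) + cos (PI * x) * cos (PI * x))) at 1
      by (rewrite h; ring).
    field.
Qed.

Lemma sin_PI_ge (d y : R) :
  0 < d -> d <= y <= 1 - d -> sin (PI * d) <= sin (PI * y).
Proof.
  intros hd [h1 h2]. pose proof PI_RGT_0.
  destruct (Rle_dec y (1 / 2)).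
  - apply sin_incr_1; nra.
  - replace (sin (PI * y)) with (sin (PI * (1 - y))).
    + apply sin_incr_1; nra.
    + rewrite <- sin_PI_x. f_equal. ring.
Qed.

Lemma cos_odd_half (K : nat) : cos ((2 * INR K + 1) * PI * (1 / 2)) = 0.
Proof.
  apply cos_eq_0_1. exists (Z.of_nat K). rewrite <- INR_IZR_INZ. field.
Qed.

(** Each term is a multiple of sin(pi k). The point 1/2 serves as base point of the error estimate:
    the partial sum, 1/2 - x and the cosine correction ([cos_odd_half]) all vanish there. *)
Lemma bern_sum_1_half (K : nat) : bern_sum 1 K (1 / 2) = 0.
Proof.
  unfold bern_sum. induction K as [|K IH]; [apply sum_1_0|].
  rewrite sum_1_S, IH. unfold bern_term.
  replace (2 * PI * INR (S K) * (1 / 2) - INR 1 * (PI / 2))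
    with (IZR (Z.of_nat K) * PI + PI / 2).
  - rewrite (cos_eq_0_1 (_ + PI / 2)); [unfold Rdiv; ring|]. now exists (Z.of_nat K).
  - rewrite S_INR, <- INR_IZR_INZ. simpl (INR 1). field.
Qed.

(* The cosine term is the first step of an integration by parts of the
   Dirichlet kernel; it removes the oscillation, so that the derivative of
   the corrected error is O(1/K). *)
Lemma bern_sum_1_rate (K : nat) (d x : R) :
  0 < d -> d <= x <= 1 - d ->
  Rabs ((1 / 2 - x) - bern_sum 1 K x) <= / (2 * INR K + 1) * / sin (PI * d) ^ 2.
Proof.
  intros hd hx. set (N := 2 * INR K + 1). set (s := sin (PI * d)).
  assert (hN : 1 <= N) by (unfold N; pose proof (pos_INR K); lra).
  pose proof PI_RGT_0 as hpi.
  assert (hpi2 : 2 <= PI) by (pose proof PI2_1; lra).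
  assert (hs : 0 < s) by (apply sin_gt_0; nra).
  assert (hs1 : s <= 1) by apply SIN_bound.
  assert (hmin : forall y, Rmin (1 / 2) x <= y <= Rmax (1 / 2) x -> s <= sin (PI * y)).
  { intros y hy. apply sin_PI_ge; [exact hd|].
    unfold Rmin, Rmax in hy. destruct (Rle_dec (1 / 2) x); lra. }
  assert (hcor : forall t, s <= sin (PI * t) -> is_derive
    (fun y => bern_sum 1 K y - (1 / 2 - y) + cos (N * PI * y) / (N * PI * sin (PI * y))) t
    (- (cos (N * PI * t) * cos (PI * t)) / (N * sin (PI * t) ^ 2))).
  { intros t ht.
    assert (hst : sin (PI * t) <> 0) by lra.
    replace (- (cos (N * PI * t) * cos (PI * t)) / (N * sin (PI * t) ^ 2))
      (* The first summand is the derivative of [bern_sum 1 K y - (1 / 2 - y)], that is sin(N pi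
         t)/sin(pi t); the derivative of the correction contains the opposite of this quotient, and
         only the term with 1/N survives. *)
      with ((bern_sum 0 K t + 1) +
            (- (cos (N * PI * t) * cos (PI * t)) / (N * sin (PI * t) ^ 2)
             - sin (N * PI * t) / sin (PI * t))).
    2:{ unfold N at 3. rewrite <- dirichlet_identity. field. lra. }
    apply @is_derive_plus.
    - apply (is_derive_ext (fun y => bern_sum 1 K y + (y - 1 / 2))); [intros u; simpl; ring|].
      apply @is_derive_plus; [apply is_derive_bern_sum|].
      auto_derive; [exact I|ring].
    - auto_derive.
      + apply Rmult_integral_contrapositive_currified; [nra|exact hst].
      + field. repeat split; lra. }
  destruct (MVT_gen _ (1 / 2) x _ (fun t ht => hcor t (hmin t (conj (Rlt_le _ _ (proj1 ht)) (Rlt_le _ _ (proj2 ht))))))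
    as [c [hc he]].
  { intros t ht.
    refine (proj2 (continuity_pt_filterlim _ _) (ex_derive_continuous _ t _)).
    eexists. apply hcor, hmin, ht. }
  rewrite bern_sum_1_half, (cos_odd_half K : cos (N * PI * (1 / 2)) = 0) in he.
  pose proof (hmin c hc) as hsc.
  set (E := - (cos (N * PI * c) * cos (PI * c)) / (N * sin (PI * c) ^ 2)) in he.
  assert (hx2 : s <= sin (PI * x)) by (apply sin_PI_ge; assumption).
  assert (hprod : forall u v, Rabs (cos u * cos v) <= 1).
  { intros u v. rewrite Rabs_mult, <- (Rmult_1_l 1).
    apply Rmult_le_compat; try apply Rabs_pos; apply Rabs_le, COS_bound. }
  assert (hden : forall u, s <= u -> 0 < N * s ^ 2 <= N * u ^ 2).
  { intros u hu. assert (0 < s ^ 2 <= u ^ 2) by (simpl; nra). nra. }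
  assert (hE : Rabs E <= / (N * s ^ 2)).
  { unfold E, Rdiv. destruct (hden _ hsc) as [h1 h2].
    rewrite Rabs_mult, Rabs_Ropp, Rabs_inv, (Rabs_right (N * _)) by lra.
    rewrite <- (Rmult_1_l (/ (N * s ^ 2))).
    apply Rmult_le_compat; [apply Rabs_pos| |apply hprod|].
    - left. apply Rinv_0_lt_compat. lra.
    - now apply Rinv_le_contravar. }
  (* The error is the correction at x minus E (x - 1/2), and each part takes half of the bound: the
     correction because pi >= 2 and s <= 1, the other because |x - 1/2| <= 1/2. *)
  assert (hC : Rabs (cos (N * PI * x) / (N * PI * sin (PI * x))) <= / (N * s ^ 2) * (1 / 2)).
  { unfold Rdiv. assert (h1 : 0 < N * s ^ 2 * 2 <= N * PI * sin (PI * x)).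
    { destruct (hden s (Rle_refl _)). split; [lra|].
      assert (s ^ 2 * 2 <= PI * sin (PI * x)); [|nra].
      simpl. assert (s * s <= sin (PI * x)) by nra. nra. }
    rewrite Rabs_mult, Rabs_inv, (Rabs_right (N * _ * _)) by lra.
    rewrite Rmult_1_l, <- Rinv_mult.
    rewrite <- (Rmult_1_l (/ (N * s ^ 2 * 2))).
    apply Rmult_le_compat; [apply Rabs_pos| |apply Rabs_le, COS_bound|].
    - left. apply Rinv_0_lt_compat. lra.
    - apply Rinv_le_contravar; lra. }
  rewrite <- Rinv_mult.
  replace ((1 / 2 - x) - bern_sum 1 K x)
    with (cos (N * PI * x) / (N * PI * sin (PI * x)) - E * (x - 1 / 2)).
  2:{ rewrite <- he. unfold Rdiv. ring. }
  assert (hEx : Rabs (E * (x - 1 / 2)) <= / (N * s ^ 2) * (1 / 2)).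
  { rewrite Rabs_mult. apply Rmult_le_compat; try apply Rabs_pos; [exact hE|].
    apply Rabs_le. lra. }
  eapply Rle_trans; [apply Rabs_triang|]. rewrite Rabs_Ropp. lra.
Qed.

(** The number d is both the radius of the ball and the distance kept from 0 and 1: the hypotheses
    place the ball inside [d, 1 - d], where one rate holds throughout. *)
Lemma CVU_bern_1 (d : posreal) (c : R) :
  d <= c - d -> c + d <= 1 - d ->
  CVU (bern_sum 1) (fun x => 1 / 2 - x) c d.
Proof.
  intros h1 h2 eps he.
  assert (hd : 0 < d) by apply cond_pos.
  assert (hs : 0 < sin (PI * d) ^ 2).
  { apply pow_lt, sin_gt_0; pose proof PI_RGT_0; nra. }
  destruct (inv_INR_eventually (eps * sin (PI * d) ^ 2)) as [N [hN h]]; [nra|].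
  exists N. intros K y hK hy. unfold Boule in hy. apply Rabs_def2 in hy.
  eapply Rle_lt_trans; [apply (bern_sum_1_rate K d y); lra|].
  apply (Rmult_lt_reg_r (sin (PI * d) ^ 2)); [exact hs|].
  rewrite Rmult_assoc, Rinv_l, Rmult_1_r by lra.
  eapply Rle_lt_trans; [|apply (h K hK)].
  assert (0 < INR K) by (apply lt_0_INR; lia).
  apply Rinv_le_contravar; lra.
Qed.

Lemma unit_ball (x : R) : 0 < x < 1 ->
  exists d : posreal, d <= x - d /\ x + d <= 1 - d.
Proof.
  intros hx. assert (h : 0 < Rmin x (1 - x) / 2) by (apply Rdiv_lt_0_compat; [apply Rmin_pos|]; lra).
  exists (mkposreal _ h). simpl. pose proof (Rmin_l x (1 - x)). pose proof (Rmin_r x (1 - x)). lra.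
Qed.

Lemma Boule_center (x : R) (d : posreal) : Boule x d x.
Proof. unfold Boule. rewrite Rminus_diag, Rabs_R0. apply cond_pos. Qed.

Lemma is_lim_bern_sum_1_unit (x : R) :
  0 < x < 1 -> is_lim_seq (fun K => bern_sum 1 K x) (1 / 2 - x).
Proof.
  intros hx. destruct (unit_ball x hx) as [d [h1 h2]].
  apply is_lim_seq_Reals.
  exact (CVU_cv _ _ _ _ (CVU_bern_1 d x h1 h2) x (Boule_center x d)).
Qed.

Lemma bern_1_unit (x : R) : 0 < x < 1 -> bern 1 x = 1 / 2 - x.
Proof.
  intros hx. unfold bern.
  now rewrite (is_lim_seq_unique _ _ (is_lim_bern_sum_1_unit x hx)).
Qed.

(** * Values at the integers and their relation to zeta *)

Lemma cos_INR_PI2_even (r : nat) : cos (INR (2 * r) * (PI / 2)) = (-1) ^ r.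
Proof.
  induction r as [|r IH].
  - simpl. rewrite Rmult_0_l. apply cos_0.
  - replace (INR (2 * S r) * (PI / 2)) with (INR (2 * r) * (PI / 2) + PI).
    + rewrite neg_cos, IH. simpl. ring.
    + rewrite !mult_INR, (S_INR r). simpl (INR 2). field.
Qed.

Lemma cos_INR_PI2_odd (r : nat) : cos (INR (2 * r + 1) * (PI / 2)) = 0.
Proof.
  apply cos_eq_0_1. exists (Z.of_nat r).
  rewrite plus_INR, mult_INR, <- INR_IZR_INZ. simpl (INR 2). simpl (INR 1). field.
Qed.

Lemma bern_term_0 (n k : nat) :
  bern_term n k 0 = 2 * cos (INR n * (PI / 2)) / (2 * PI) ^ n * / INR k ^ n.
Proof.
  unfold bern_term. rewrite Rmult_0_r, Rminus_0_l, cos_neg, Rpow_mult_distr.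
  unfold Rdiv. rewrite Rinv_mult. ring.
Qed.

Lemma bern_sum_0 (n K : nat) :
  bern_sum n K 0 =
  2 * cos (INR n * (PI / 2)) / (2 * PI) ^ n * sum_n_m (fun k => / INR k ^ n) 1 K.
Proof.
  unfold bern_sum. induction K as [|K IH]; [rewrite !sum_1_0; ring|].
  rewrite !sum_1_S, IH, bern_term_0. ring.
Qed.

Lemma bern_sum_odd_0 (r K : nat) : bern_sum (2 * r + 1) K 0 = 0.
Proof. rewrite bern_sum_0, cos_INR_PI2_odd. unfold Rdiv. ring. Qed.

Lemma bern_odd_0 (r : nat) : bern (2 * r + 1) 0 = 0.
Proof.
  unfold bern. rewrite (Lim_seq_ext _ (fun _ => 0)); [now rewrite Lim_seq_const|].
  intros K. apply bern_sum_odd_0.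
Qed.

Lemma bern_even_0 (r : nat) :
  (1 <= r)%nat -> bern (2 * r) 0 = (-1) ^ r * (2 / (2 * PI) ^ (2 * r)) * zeta (2 * r).
Proof.
  intros hr. set (c := (-1) ^ r * (2 / (2 * PI) ^ (2 * r))).
  assert (hc : c <> 0).
  { apply Rmult_integral_contrapositive_currified; [apply pow_nonzero; lra|].
    apply Rmult_integral_contrapositive_currified; [lra|].
    apply Rinv_neq_0_compat, pow_nonzero. pose proof PI_RGT_0. lra. }
  assert (hz : zeta (2 * r) = bern (2 * r) 0 / c); [|rewrite hz; field; exact hc].
  unfold zeta, Series.
  (* The series of [zeta] is indexed from 0, so its partial sum of index K has K + 1 terms and
     matches [bern_sum] of order S K. *)
  assert (hl : is_lim_seq (sum_n (fun k => / INR (S k) ^ (2 * r))) (bern (2 * r) 0 / c)).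
  { apply (is_lim_seq_ext (fun K => bern_sum (2 * r) (S K) 0 / c)).
    - intros K. rewrite bern_sum_0, cos_INR_PI2_even. unfold sum_n.
      rewrite (sum_n_m_S (fun k => / INR k ^ (2 * r))). fold (2 / (2 * PI) ^ (2 * r)).
      replace (2 * (-1) ^ r / (2 * PI) ^ (2 * r)) with c by (unfold c, Rdiv; ring).
      field. exact hc.
    - apply is_lim_seq_mult'; [|apply is_lim_seq_const].
      apply (is_lim_seq_incr_1 (fun K => bern_sum (2 * r) K 0)).
      apply is_lim_bern_sum_ge2. lia. }
  now rewrite (is_lim_seq_unique _ _ hl).
Qed.

(** For n = 1 there is no summable majorant; periodicity moves x to its fractional part. Strictly
    inside (0,1) the sawtooth rate applies, and at an integer all partial sums are 0, the midpoint
    of the jump. *)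
Lemma is_lim_bern_sum (n : nat) (x : R) :
  (1 <= n)%nat -> is_lim_seq (fun K => bern_sum n K x) (bern n x).
Proof.
  intros hn. destruct (Nat.eq_dec n 1) as [->|hn1]; [|apply is_lim_bern_sum_ge2; lia].
  replace x with ((x - IZR (Int_part x)) + IZR (Int_part x)) by ring.
  rewrite bern_period.
  eapply is_lim_seq_ext; [intros K; symmetry; apply bern_sum_period|].
  fold (frac_part x). destruct (base_fp x) as [[h|h] h1].
  - rewrite bern_1_unit by lra. apply is_lim_bern_sum_1_unit. lra.
  - rewrite h. rewrite (bern_odd_0 0 : bern 1 0 = 0).
    eapply is_lim_seq_ext; [intros K; symmetry; apply (bern_sum_odd_0 0)|].
    apply is_lim_seq_const.
Qed.

Lemma CVU_bern (n : nat) (c : R) (d : posreal) :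
  (2 <= n)%nat -> CVU (bern_sum n) (bern n) c d.
Proof.
  intros hn eps he. destruct (inv_INR_eventually eps he) as [N [hN h]].
  exists N. intros K y hK _.
  eapply Rle_lt_trans; [apply bern_sum_rate; lia|auto].
Qed.

Lemma continuity_bern (n : nat) (x : R) : (2 <= n)%nat -> continuity_pt (bern n) x.
Proof.
  intros hn.
  apply (CVU_continuity _ _ x (mkposreal 1 Rlt_0_1) (CVU_bern n x _ hn)).
  - intros K y _. apply continuity_bern_sum.
  - apply Boule_center.
Qed.

(** Term by term differentiation needs uniform convergence of the differentiated series only near x;
    for n = 1 this is available just away from the integers, hence the open interval. *)
Lemma is_derive_bern_unit (n : nat) (x : R) :
  (1 <= n)%nat -> 0 < x < 1 -> is_derive (bern (S n)) x (bern n x).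
Proof.
  intros hn hx. destruct (unit_ball x hx) as [d [h1 h2]].
  assert (hu : CVU (bern_sum n) (bern n) x d).
  { destruct (Nat.eq_dec n 1) as [->|hn1]; [|apply CVU_bern; lia].
    apply (CVU_ext_lim _ _ _ _ _ (CVU_bern_1 d x h1 h2)).
    intros y hy. unfold Boule in hy. apply Rabs_def2 in hy.
    pose proof (cond_pos d). symmetry. apply bern_1_unit. lra. }
  apply is_derive_Reals.
  apply (CVU_derivable (bern_sum (S n)) (bern_sum n) _ _ x d hu).
  - intros y _. apply is_lim_seq_Reals, is_lim_bern_sum. lia.
  - intros K y _. apply is_derive_Reals, is_derive_bern_sum.
  - apply Boule_center.
Qed.

Lemma is_derive_bern (n : nat) (i : Z) (x : R) :
  (1 <= n)%nat -> IZR i < x < IZR i + 1 -> is_derive (bern (S n)) x (bern n x).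
Proof.
  intros hn hx.
  assert (hs : forall k y, bern k y = bern k (y - IZR i)).
  { intros k y. rewrite <- (bern_period k i (y - IZR i)). f_equal. ring. }
  rewrite (hs n x).
  apply (is_derive_ext (fun y => bern (S n) (y - IZR i))); [intros y; now rewrite <- hs|].
  rewrite <- (Rmult_1_l (bern n (x - IZR i))).
  apply (is_derive_comp (bern (S n)) (fun y => y - IZR i)).
  - apply is_derive_bern_unit; [exact hn|lra].
  - auto_derive; [exact I|ring].
Qed.

Lemma bern_1_eq (i : Z) (x : R) :
  IZR i < x < IZR i + 1 -> bern 1 x = 1 / 2 - (x - IZR i).
Proof.
  intros hx. rewrite <- bern_1_unit by lra.
  rewrite <- (bern_period 1 i (x - IZR i)). f_equal. ring.
Qed.

Lemma dirichlet_kernel_eq (p : nat) (i : Z) (x : R) :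
  IZR i < x < IZR i + 1 -> dirichlet_kernel p x = 1 + bern_sum 0 p x.
Proof.
  intros hx.
  assert (hni : forall z, x <> IZR z).
  { intros z ->. rewrite <- plus_IZR in hx. destruct hx as [h1 h2].
    apply lt_IZR in h1. apply lt_IZR in h2. lia. }
  unfold dirichlet_kernel. destruct (Req_EM_T (frac_part x) 0) as [h|h].
  - exfalso. apply (hni (Int_part x)). unfold frac_part in h. lra.
  - rewrite <- dirichlet_identity. field. intros hs.
    apply sin_eq_0_0 in hs. destruct hs as [z hz]. apply (hni z).
    apply (Rmult_eq_reg_l PI); [lra|apply PI_neq0].
Qed.

(** * The complex Fourier tail *)

Lemma Zsum_empty {G : AbelianMonoid} (u : Z -> G) (lo : Z) : Zsum u lo (lo - 1) = zero.
Proof.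
  unfold Zsum. replace (lo - 1 - lo + 1)%Z with 0%Z by ring.
  apply sum_n_m_zero. simpl. lia.
Qed.

Lemma Zsum_succ_r {G : AbelianMonoid} (u : Z -> G) (lo hi : Z) :
  (lo <= hi + 1)%Z -> Zsum u lo (hi + 1) = plus (Zsum u lo hi) (u (hi + 1)%Z).
Proof.
  intros h. unfold Zsum.
  replace (Z.to_nat (hi + 1 - lo + 1)) with (S (Z.to_nat (hi - lo + 1))) by lia.
  rewrite sum_n_Sm by lia. f_equal. f_equal. lia.
Qed.

Lemma Zsum_split {G : AbelianMonoid} (u : Z -> G) (lo mid : Z) (n : nat) :
  (lo <= mid + 1)%Z ->
  Zsum u lo (mid + Z.of_nat n) = plus (Zsum u lo mid) (Zsum u (mid + 1) (mid + Z.of_nat n)).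
Proof.
  intros h. induction n as [|n IH].
  - rewrite Z.add_0_r. pose proof (Zsum_empty u (mid + 1)) as h0.
    rewrite Z.add_simpl_r in h0. now rewrite h0, plus_zero_r.
  - rewrite Nat2Z.inj_succ, <- Z.add_1_r, Z.add_assoc.
    rewrite !Zsum_succ_r, IH by lia. now rewrite plus_assoc.
Qed.

Lemma Zsum_single {G : AbelianMonoid} (u : Z -> G) (lo : Z) : Zsum u lo lo = u lo.
Proof.
  pose proof (Zsum_succ_r u lo (lo - 1) ltac:(lia)) as h.
  rewrite Z.sub_add in h. now rewrite h, Zsum_empty, plus_zero_l.
Qed.

(** Enlarging the symmetric window adds two opposite indices at once, so an induction on K sees only
    the pairs k, -k. *)
Lemma Zsum_symmetric_succ {G : AbelianMonoid} (u : Z -> G) (K : nat) :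
  Zsum u (- Z.of_nat (S K)) (Z.of_nat (S K)) =
  plus (Zsum u (- Z.of_nat K) (Z.of_nat K)) (plus (u (Z.of_nat (S K))) (u (- Z.of_nat (S K))%Z)).
Proof.
  replace (Z.of_nat (S K)) with (Z.of_nat K + 1)%Z at 2 by lia.
  rewrite Zsum_succ_r by lia.
  replace (Z.of_nat K) with (- Z.of_nat (S K) + Z.of_nat (2 * K + 1))%Z at 1 by lia.
  rewrite Zsum_split, Zsum_single by lia.
  replace (- Z.of_nat (S K) + 1)%Z with (- Z.of_nat K)%Z by lia.
  replace (- Z.of_nat (S K) + Z.of_nat (2 * K + 1))%Z with (Z.of_nat K) by lia.
  replace (Z.of_nat K + 1)%Z with (Z.of_nat (S K)) by lia.
  rewrite <- plus_assoc, plus_comm, <- plus_assoc. reflexivity.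
Qed.

Lemma Zsum_ext {G : AbelianMonoid} (u v : Z -> G) (lo hi : Z) :
  (forall i, (lo <= i <= hi)%Z -> u i = v i) -> Zsum u lo hi = Zsum v lo hi.
Proof. intros h. apply sum_n_m_ext_loc. intros k hk. apply h. lia. Qed.

Definition cis (t : R) : C := (cos t, sin t).

Lemma cis_plus (s t : R) : cis (s + t) = (cis s * cis t)%C.
Proof. unfold cis, Cmult; simpl. rewrite cos_plus, sin_plus. f_equal. ring. Qed.

Lemma cis_pow (t : R) (n : nat) : (cis t ^ n)%C = cis (INR n * t).
Proof.
  induction n as [|n IH].
  - simpl. rewrite Rmult_0_l. unfold cis. now rewrite cos_0, sin_0.
  - rewrite Cpow_S, IH, <- cis_plus, S_INR. f_equal. ring.
Qed.

Lemma cis_neq_0 (t : R) : cis t <> 0%C.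
Proof.
  unfold cis. intros h. injection h as h1 h2.
  pose proof (sin2_cos2 t) as h. rewrite h1, h2 in h. unfold Rsqr in h. lra.
Qed.

(** With i = cis(pi/2) and -i = cis(-pi/2), division by the n-th power becomes a phase shift; this
    produces the -n pi/2 in [bern_term], with opposite phases for k and -k. *)
Lemma cis_div (w s t : R) (n : nat) : w <> 0 ->
  (cis s / (RtoC w * cis t) ^ n)%C = (cis (s - INR n * t) / RtoC (w ^ n))%C.
Proof.
  intros hw. rewrite Cpow_mult_l, cis_pow, <- RtoC_pow.
  replace (cis s) with (cis (s - INR n * t) * cis (INR n * t))%C
    by (rewrite <- cis_plus; f_equal; ring).
  field. split; [|apply cis_neq_0].
  intros h. injection h as h. revert h. now apply pow_nonzero.
Qed.

Lemma Cexp_imaginary (t : R) : Cexp (RtoC t * Ci) = cis t.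
Proof.
  unfold Cexp, cis, Cmult, Ci; simpl.
  replace (t * 0 - 0 * 1) with 0 by ring. replace (t * 1 + 0 * 0) with t by ring.
  now rewrite exp_0, !Rmult_1_l.
Qed.

Lemma Ci_cis : Ci = cis (PI / 2).
Proof. unfold cis. now rewrite cos_PI2, sin_PI2. Qed.

Lemma Ci_opp_cis : (- Ci)%C = cis (- (PI / 2)).
Proof.
  unfold cis. rewrite cos_neg, sin_neg, cos_PI2, sin_PI2.
  unfold Copp, Ci; simpl. now rewrite Ropp_0.
Qed.

Lemma fourier_tail_term_pair (n k : nat) (x : R) : (0 < k)%nat ->
  (fourier_tail_term n x (Z.of_nat k) + fourier_tail_term n x (- Z.of_nat k))%C
  = RtoC (bern_term n k x).
Proof.
  intros hk. pose proof (PI_INR_pos k hk) as hw.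
  unfold fourier_tail_term, bern_term.
  rewrite opp_IZR, <- INR_IZR_INZ. set (w := 2 * PI * INR k) in *.
  replace (2 * PI * Ci * INR k * x)%C with (RtoC (w * x) * Ci)%C
    by (unfold w; rewrite !RtoC_mult; ring).
  replace (2 * PI * Ci * RtoC (- INR k) * x)%C with (RtoC (- (w * x)) * Ci)%C
    by (unfold w; rewrite !RtoC_opp, !RtoC_mult; ring).
  replace (2 * PI * Ci * INR k)%C with (RtoC w * cis (PI / 2))%C
    by (rewrite <- Ci_cis; unfold w; rewrite !RtoC_mult; ring).
  replace (2 * PI * Ci * RtoC (- INR k))%C with (RtoC w * cis (- (PI / 2)))%C
    by (rewrite <- Ci_opp_cis; unfold w; rewrite !RtoC_opp, !RtoC_mult; ring).
  rewrite !Cexp_imaginary, !cis_div by lra.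
  replace (- (w * x) - INR n * - (PI / 2)) with (- (w * x - INR n * (PI / 2))) by ring.
  set (t := w * x - INR n * (PI / 2)).
  assert (hn : w ^ n <> 0) by (apply pow_nonzero; lra).
  rewrite RtoC_div by exact hn.
  replace (RtoC (2 * cos t)) with (cis t + cis (- t))%C.
  - field. intros h. injection h as h. contradiction.
  - unfold cis, Cplus, RtoC; simpl. rewrite cos_neg, sin_neg. f_equal; ring.
Qed.

(** The minimum covers K <= p, where every term is masked and the right side is 0; the induction can
    thus start at K = 0. *)
Lemma bern_tail_sum (n p K : nat) (x : R) :
  Zsum (fun k : Z => if (Z.of_nat p <? Z.abs k)%Z
                     then fourier_tail_term n x k else RtoC 0)
       (- Z.of_nat K) (Z.of_nat K)
  = RtoC (bern_sum n K x - bern_sum n (Nat.min K p) x).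
Proof.
  induction K as [|K IH].
  - change (- Z.of_nat 0)%Z with 0%Z. change (Z.of_nat 0) with 0%Z. rewrite Zsum_single.
    destruct (Z.ltb_spec (Z.of_nat p) (Z.abs 0)); [lia|].
    now rewrite Nat.min_0_l, Rminus_diag.
  - rewrite Zsum_symmetric_succ, IH.
    rewrite Z.abs_opp, Z.abs_eq by lia.
    unfold bern_sum at 3. rewrite sum_1_S. fold (bern_sum n K x).
    destruct (Z.ltb_spec (Z.of_nat p) (Z.of_nat (S K))).
    + change plus with Cplus. rewrite fourier_tail_term_pair, <- RtoC_plus by lia.
      replace (Nat.min (S K) p) with (Nat.min K p) by lia. f_equal. ring.
    + change plus with Cplus. rewrite <- !RtoC_plus.
      replace (Nat.min (S K) p) with (S K) by lia.
      replace (Nat.min K p) with K by lia.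
      unfold bern_sum at 4. rewrite sum_1_S. fold (bern_sum n K x). f_equal. ring.
Qed.

Lemma fourier_tail_eq (n p : nat) (x : R) : (1 <= n)%nat ->
  fourier_tail n p x = RtoC (bern n x - bern_sum n p x).
Proof.
  intros hn. unfold fourier_tail. 
  (* Uniqueness of limits makes [iota] return any limit that is exhibited. *)
  refine (@iota_filterlim_locally R_AbsRing C_R_CompleteNormedModule nat eventually _ _ _ _).
  apply (filterlim_ext_loc (fun K => RtoC (bern_sum n K x - bern_sum n p x))).
  - exists p. intros K hK. now rewrite bern_tail_sum, Nat.min_r.
  - assert (hl : is_lim_seq (fun K => bern_sum n K x - bern_sum n p x)
                            (bern n x - bern_sum n p x)).
    { apply is_lim_seq_minus'; [now apply is_lim_bern_sum|apply is_lim_seq_const]. }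
    apply filterlim_locally. intros eps.
    destruct (proj1 (filterlim_locally _ _) hl eps) as [N h].
    exists N. intros K hK. split; [exact (h K hK)|apply ball_center].
Qed.

Lemma is_RInt_RtoC (g : R -> R) (a b l : R) :
  is_RInt g a b l -> @is_RInt C_R_NormedModule (fun x => RtoC (g x)) a b (RtoC l).
Proof.
  intros h.
  apply (@is_RInt_fct_extend_pair R_NormedModule R_NormedModule (fun x => RtoC (g x)));
    [exact h|].
  pose proof (is_RInt_const (V := R_NormedModule) a b 0) as h0.
  change (scal (b - a) 0) with ((b - a) * 0) in h0. rewrite Rmult_0_r in h0. exact h0.
Qed.

(** * Integration by parts over unit intervals *)

Definition bern_tail (n p : nat) (x : R) : R := bern n x - bern_sum n p x.

Lemma bern_tail_IZR (n p : nat) (z : Z) : bern_tail n p (IZR z) = bern_tail n p 0.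
Proof.
  unfold bern_tail. rewrite <- (Rplus_0_l (IZR z)).
  now rewrite bern_period, bern_sum_period.
Qed.

Lemma continuity_bern_tail (n p : nat) (x : R) :
  (2 <= n)%nat -> continuity_pt (bern_tail n p) x.
Proof.
  intros hn. apply (continuity_pt_minus (bern n) (bern_sum n p)).
  - now apply continuity_bern.
  - apply continuity_bern_sum.
Qed.

Lemma is_derive_bern_tail (n p : nat) (i : Z) (x : R) :
  (1 <= n)%nat -> IZR i < x < IZR i + 1 ->
  is_derive (bern_tail (S n) p) x (bern_tail n p x).
Proof.
  intros hn hx. apply @is_derive_minus; [now apply (is_derive_bern n i)|].
  apply is_derive_bern_sum.
Qed.

(* bern 1 jumps at the integers, so integrals are computed on unit intervals,
   where it agrees with an affine function away from the endpoints. *)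
Lemma bern_tail_continuous_version (n p : nat) (i : Z) : (1 <= n)%nat ->
  exists w : R -> R, (forall x, continuity_pt w x) /\
    (forall x, IZR i < x < IZR i + 1 -> w x = bern_tail n p x).
Proof.
  intros hn. destruct (Nat.eq_dec n 1) as [->|hn1].
  - exists (fun x => (1 / 2 - (x - IZR i)) - bern_sum 1 p x). split.
    + intros x. apply (continuity_pt_minus (fun x => 1 / 2 - (x - IZR i)) (bern_sum 1 p)).
      * reg.
      * apply continuity_bern_sum.
    + intros x hx. unfold bern_tail. now rewrite (bern_1_eq i).
  - exists (bern_tail n p). split; [|reflexivity].
    intros x. apply continuity_bern_tail. lia.
Qed.

Lemma ex_RInt_continuity (g : R -> R) (a b : R) :
  (forall x, continuity_pt g x) -> ex_RInt g a b.
Proof.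
  intros h. apply (ex_RInt_continuous (V := R_CompleteNormedModule)).
  intros z _. apply continuity_pt_filterlim, h.
Qed.

Lemma is_RInt_derive_open (h psi : R -> R) (c d : R) : c < d ->
  (forall x, continuity_pt h x) -> (forall x, continuity_pt psi x) ->
  (forall x, c < x < d -> is_derive h x (psi x)) ->
  is_RInt psi c d (h d - h c).
Proof.
  intros hcd hh hpsi hder.
  assert (hPhi : forall x, is_derive (RInt psi c) x (psi x)).
  { intros x. apply (is_derive_RInt psi (RInt psi c) c x).
    - apply filter_forall. intros y.
      apply (RInt_correct (V := R_CompleteNormedModule)). now apply ex_RInt_continuity.
    - apply continuity_pt_filterlim, hpsi. }
  destruct (MVT_gen (fun x => h x - RInt psi c x) c d (fun _ => 0)) as [xi [_ he]].
  - rewrite Rmin_left, Rmax_right by lra. intros x hx.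
    replace 0 with (psi x - psi x) by ring.
    apply @is_derive_minus; [now apply hder|apply hPhi].
  - intros x _. apply (continuity_pt_minus h (RInt psi c)); [apply hh|].
    refine (proj2 (continuity_pt_filterlim _ _) (ex_derive_continuous _ x _)).
    eexists. apply hPhi.
  - rewrite RInt_point in he. change (@zero R_CompleteNormedModule) with 0 in he.
    replace (h d - h c) with (RInt psi c d) by lra.
    apply (RInt_correct (V := R_CompleteNormedModule)). now apply ex_RInt_continuity.
Qed.

Lemma unit_interval (i : Z) (x : R) :
  Rmin (IZR i) (IZR (i + 1)) < x < Rmax (IZR i) (IZR (i + 1)) ->
  IZR i < x < IZR i + 1.
Proof. rewrite plus_IZR, Rmin_left, Rmax_right; lra. Qed.

Lemma IZR_lt_succ (i : Z) : IZR i < IZR (i + 1).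
Proof. apply IZR_lt. lia. Qed.

(** Only the values of a primitive at the integers enter, so [I] is indexed by Z. It may be
    discontinuous as a function of a real variable. *)
Lemma is_RInt_units (phi : R -> R) (I : Z -> R) (c : Z) (N : nat) :
  (forall i, (c <= i < c + Z.of_nat N)%Z ->
     is_RInt phi (IZR i) (IZR (i + 1)) (I (i + 1)%Z - I i)) ->
  is_RInt phi (IZR c) (IZR (c + Z.of_nat N)) (I (c + Z.of_nat N)%Z - I c).
Proof.
  induction N as [|N IH]; intros h.
  - rewrite Z.add_0_r, Rminus_diag. apply (is_RInt_point (V := R_NormedModule)).
  - rewrite Nat2Z.inj_succ, <- Z.add_1_r, Z.add_assoc.
    replace (I (c + Z.of_nat N + 1)%Z - I c)
      with ((I (c + Z.of_nat N)%Z - I c)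
            + (I (c + Z.of_nat N + 1)%Z - I (c + Z.of_nat N)%Z)) by ring.
    apply (is_RInt_Chasles (V := R_NormedModule) phi _ (IZR (c + Z.of_nat N))).
    + apply IH. intros i hi. apply h. lia.
    + apply h. lia.
Qed.

Lemma ex_RInt_units (phi : R -> R) (c : Z) (N : nat) :
  (forall i, ex_RInt phi (IZR i) (IZR (i + 1))) ->
  ex_RInt phi (IZR c) (IZR (c + Z.of_nat N)).
Proof.
  intros h. induction N as [|N IH].
  - rewrite Z.add_0_r. apply (ex_RInt_point (V := R_NormedModule)).
  - rewrite Nat2Z.inj_succ, <- Z.add_1_r, Z.add_assoc.
    apply (ex_RInt_Chasles (V := R_NormedModule) phi _ _ _ IH (h _)).
Qed.

Lemma ex_RInt_bern_tail (n p : nat) (g : R -> R) (c : Z) (N : nat) :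
  (1 <= n)%nat -> (forall x, continuity_pt g x) ->
  ex_RInt (fun x => bern_tail n p x * g x) (IZR c) (IZR (c + Z.of_nat N)).
Proof.
  intros hn hg. apply ex_RInt_units. intros i.
  destruct (bern_tail_continuous_version n p i hn) as [w [hw hwe]].
  apply (ex_RInt_ext (V := R_NormedModule) (fun x => w x * g x)).
  - intros x hx. rewrite hwe; [reflexivity|now apply unit_interval].
  - apply ex_RInt_continuity. intros x. now apply (continuity_pt_mult w g).
Qed.

Lemma ex_RInt_dirichlet (p : nat) (g : R -> R) (c : Z) (N : nat) :
  (forall x, continuity_pt g x) ->
  ex_RInt (fun x => dirichlet_kernel p x * g x) (IZR c) (IZR (c + Z.of_nat N)).
Proof.
  intros hg. apply ex_RInt_units. intros i.
  apply (ex_RInt_ext (V := R_NormedModule) (fun x => (1 + bern_sum 0 p x) * g x)).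
  - intros x hx. rewrite (dirichlet_kernel_eq p i); [reflexivity|now apply unit_interval].
  - apply ex_RInt_continuity. intros x.
    apply (continuity_pt_mult (fun x => 1 + bern_sum 0 p x) g); [|apply hg].
    apply (continuity_pt_plus (fun _ => 1) (bern_sum 0 p)); [|apply continuity_bern_sum].
    apply continuity_pt_const. intros ? ?. reflexivity.
Qed.

Lemma bern_tail_by_parts (n p : nat) (g g' : R -> R) (c : Z) (N : nat) :
  (1 <= n)%nat -> (forall x, continuity_pt g x) -> (forall x, continuity_pt g' x) ->
  (forall x, IZR c < x < IZR (c + Z.of_nat N) -> is_derive g x (g' x)) ->
  is_RInt (fun x => bern_tail n p x * g x + bern_tail (S n) p x * g' x)
    (IZR c) (IZR (c + Z.of_nat N))
    (bern_tail (S n) p 0 * g (IZR (c + Z.of_nat N)) - bern_tail (S n) p 0 * g (IZR c)).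
Proof.
  intros hn hg hg' hder.
  apply (is_RInt_units _ (fun i => bern_tail (S n) p 0 * g (IZR i))). intros i hi.
  destruct (bern_tail_continuous_version n p i hn) as [w [hw hwe]].
  assert (hle : IZR c <= IZR i /\ IZR (i + 1) <= IZR (c + Z.of_nat N))
    by (split; apply IZR_le; lia).
  apply (is_RInt_ext (V := R_NormedModule)
           (fun x => w x * g x + bern_tail (S n) p x * g' x)).
  { intros x hx. rewrite hwe; [reflexivity|now apply unit_interval]. }
  (* The common value at 0 is rewritten as the values at i + 1 and at i, so that the increment
     becomes that of the product to be differentiated. *)
  rewrite <- (bern_tail_IZR (S n) p (i + 1)) at 1. rewrite <- (bern_tail_IZR (S n) p i).
  assert (hct : forall x, continuity_pt (bern_tail (S n) p) x)
    by (intros x; apply continuity_bern_tail; lia).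
  apply (is_RInt_derive_open (fun x => bern_tail (S n) p x * g x)).
  - apply IZR_lt_succ.
  - intros x. now apply (continuity_pt_mult (bern_tail (S n) p) g).
  - intros x. apply (continuity_pt_plus (fun x => w x * g x) (fun x => bern_tail (S n) p x * g' x)).
    + now apply (continuity_pt_mult w g).
    + now apply (continuity_pt_mult (bern_tail (S n) p) g').
  - intros x hx. assert (hx' : IZR i < x < IZR i + 1) by (rewrite plus_IZR in hx; lra).
    rewrite hwe by exact hx'.
    apply is_derive_Reals, derivable_pt_lim_mult; apply is_derive_Reals.
    + now apply (is_derive_bern_tail n p i).
    + apply hder. lra.
Qed.

Lemma trapezoid_by_parts (p : nat) (g g' : R -> R) (c : Z) (N : nat) :
  (forall x, continuity_pt g x) -> (forall x, continuity_pt g' x) ->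
  (forall x, IZR c < x < IZR (c + Z.of_nat N) -> is_derive g x (g' x)) ->
  is_RInt (fun x => dirichlet_kernel p x * g x - bern_tail 1 p x * g' x)
    (IZR c) (IZR (c + Z.of_nat N))
    (Zsum (fun i => g (IZR i)) c (c + Z.of_nat N)
     - (g (IZR c) + g (IZR (c + Z.of_nat N))) / 2).
Proof.
  intros hg hg' hder.
  (* [I z] is the trapezoid sum from c to z: it vanishes at c and grows by (g(i) + g(i+1))/2 on each
     unit interval. *)
  set (I := fun z => Zsum (fun i => g (IZR i)) c z - (g (IZR c) + g (IZR z)) / 2).
  assert (hIc : I c = 0) by (unfold I; rewrite Zsum_single; field).
  fold (I (c + Z.of_nat N)%Z). rewrite <- (Rminus_0_r (I _)), <- hIc.
  apply is_RInt_units. intros i hi.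
  assert (hle : IZR c <= IZR i /\ IZR (i + 1) <= IZR (c + Z.of_nat N))
    by (split; apply IZR_le; lia).
  (* The derivative of w is minus the Dirichlet kernel, and w is 1/2 at i and
     -1/2 at i+1, which gives the trapezoid rule. *)
  set (w := fun x => (1 / 2 - (x - IZR i)) - bern_sum 1 p x).
  assert (hwd : forall x, is_derive w x (- (1 + bern_sum 0 p x))).
  { intros x. replace (- (1 + bern_sum 0 p x)) with (-1 - bern_sum 0 p x) by ring.
    apply @is_derive_minus; [auto_derive; [exact Logic.I|ring]|apply is_derive_bern_sum]. }
  assert (hw : forall x, continuity_pt w x).
  { intros x. refine (proj2 (continuity_pt_filterlim _ _) (ex_derive_continuous _ x _)).
    eexists. apply hwd. }
  replace (I (i + 1)%Z - I i)
    with ((fun x => - (w x * g x)) (IZR (i + 1)) - (fun x => - (w x * g x)) (IZR i)).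
  (* The partial sum of sines vanishes at integers, so the boundary values of w do not depend on
     p. *)
  2:{ assert (hb : forall z, bern_sum 1 p (IZR z) = 0).
      { intros z. rewrite <- (Rplus_0_l (IZR z)), bern_sum_period.
        apply (bern_sum_odd_0 0). }
      unfold I, w. rewrite !hb, Zsum_succ_r, plus_IZR by lia.
      change plus with Rplus. field. }
  apply (is_RInt_ext (V := R_NormedModule)
           (fun x => (1 + bern_sum 0 p x) * g x - w x * g' x)).
  { intros x hx. apply unit_interval in hx.
    rewrite (dirichlet_kernel_eq p i) by exact hx.
    unfold bern_tail, w. now rewrite (bern_1_eq i). }
  apply (is_RInt_derive_open (fun x => - (w x * g x))).
  - apply IZR_lt_succ.
  - intros x. apply (continuity_pt_opp (fun x => w x * g x)).
    now apply (continuity_pt_mult w g).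
  - intros x.
    apply (continuity_pt_minus (fun x => (1 + bern_sum 0 p x) * g x) (fun x => w x * g' x)).
    + apply (continuity_pt_mult (fun x => 1 + bern_sum 0 p x) g); [|apply hg].
      apply (continuity_pt_plus (fun _ => 1) (bern_sum 0 p)); [|apply continuity_bern_sum].
      apply continuity_pt_const. intros ? ?. reflexivity.
    + now apply (continuity_pt_mult w g').
  - intros x hx.
    replace ((1 + bern_sum 0 p x) * g x - w x * g' x)
      with (- (- (1 + bern_sum 0 p x) * g x + w x * g' x)) by ring.
    apply is_derive_Reals, (derivable_pt_lim_opp (fun x => w x * g x)),
      derivable_pt_lim_mult; apply is_derive_Reals; [apply hwd|].
    apply hder. lra.
Qed.

Lemma bern_tail_even_0 (r p : nat) :
  (1 <= r)%nat -> bern_tail (2 * r) p 0 = (-1) ^ r * T (2 * r) p.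
Proof.
  intros hr. unfold bern_tail, T.
  rewrite bern_even_0, bern_sum_0, cos_INR_PI2_even by exact hr. unfold Rdiv. ring.
Qed.

Lemma bern_tail_odd_0 (r p : nat) : bern_tail (2 * r + 1) p 0 = 0.
Proof. unfold bern_tail. rewrite bern_odd_0, bern_sum_odd_0. ring. Qed.

(** The family [g] stands for the successive derivatives, continuous on R but linked by
    differentiation only inside the interval. This is all that clamped one-sided derivatives
    provide. *)
Lemma euler_maclaurin (g : nat -> R -> R) (n p : nat) (c : Z) (N : nat) :
  (1 <= n)%nat ->
  (forall k x, (k <= n)%nat -> continuity_pt (g k) x) ->
  (forall k x, (k < n)%nat -> IZR c < x < IZR (c + Z.of_nat N) ->
     is_derive (g k) x (g (S k) x)) ->
  Zsum (fun i => g 0%nat (IZR i)) c (c + Z.of_nat N) =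
  RInt (fun x => dirichlet_kernel p x * g 0%nat x) (IZR c) (IZR (c + Z.of_nat N))
  + (g 0%nat (IZR c) + g 0%nat (IZR (c + Z.of_nat N))) / 2
  + sum_n_m (fun r => (-1) ^ r * T (2 * r) p *
      (g (2 * r - 1)%nat (IZR c) - g (2 * r - 1)%nat (IZR (c + Z.of_nat N)))) 1 (n / 2)
  + (-1) ^ n * RInt (fun x => bern_tail n p x * g n x) (IZR c) (IZR (c + Z.of_nat N)).
Proof.
  intros hn. induction n as [|n IH]; [lia|]. intros hc hd.
  set (b := (c + Z.of_nat N)%Z) in *.
  destruct (Nat.eq_dec n 0) as [->|hn0].
  - change (1 / 2)%nat with 0%nat. rewrite sum_1_0.
    pose proof (trapezoid_by_parts p (g 0%nat) (g 1%nat) c N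
      (fun x => hc 0%nat x ltac:(lia)) (fun x => hc 1%nat x ltac:(lia))
      (fun x hx => hd 0%nat x ltac:(lia) hx)) as h.
    fold b in h. apply (is_RInt_unique (V := R_CompleteNormedModule)) in h.
    rewrite (RInt_minus (V := R_CompleteNormedModule)) in h.
    + change minus with Rminus in h. simpl pow. lra.
    + apply ex_RInt_dirichlet. intros x. apply hc. lia.
    + apply ex_RInt_bern_tail; [lia|]. intros x. apply hc. lia.
  - rewrite IH; [|lia|intros k x hk; apply hc; lia|intros k x hk; apply hd; lia].
    pose proof (bern_tail_by_parts n p (g n) (g (S n)) c N ltac:(lia)
      (fun x => hc n x ltac:(lia)) (fun x => hc (S n) x ltac:(lia))
      (fun x hx => hd n x ltac:(lia) hx)) as h.
    fold b in h. apply (is_RInt_unique (V := R_CompleteNormedModule)) in h.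
    rewrite (RInt_plus (V := R_CompleteNormedModule)) in h.
    2:{ apply ex_RInt_bern_tail; [lia|]. intros x. apply hc. lia. }
    2:{ apply ex_RInt_bern_tail; [lia|]. intros x. apply hc. lia. }
    change plus with Rplus in h.
    match goal with |- @eq _ ?u ?v => change (@eq R u v) end.
    set (J := RInt (fun x => bern_tail n p x * g n x) (IZR c) (IZR b)) in *.
    set (J' := RInt (fun x => bern_tail (S n) p x * g (S n) x) (IZR c) (IZR b)) in *.
    destruct (Nat.Even_or_Odd n) as [[r hr]|[r hr]].
    (* For n = 2r the boundary term is zero and the range of summation keeps its length; only the
       sign of the integral changes. *)
    + assert (h0 : bern_tail (S n) p 0 = 0)
        by (replace (S n) with (2 * r + 1)%nat by lia; apply bern_tail_odd_0).
      rewrite h0 in h. replace (S n / 2)%nat with (n / 2)%nat.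
      2:{ rewrite hr. apply (Nat.div_unique _ _ _ 1) ; [lia|].
          rewrite (Nat.mul_comm 2 r), Nat.div_mul; lia. }
      replace J with (- J') by lra. simpl pow. ring.
    (* For n = 2r + 1 the boundary term is the new summand of index r + 1, involving the derivative
       of order 2(r + 1) - 1 = n. The sign (-1)^n = -1 turns the increment from c to b into the
       difference at c minus at b. *)
    + assert (h0 : bern_tail (S n) p 0 = (-1) ^ S r * T (2 * S r) p)
        by (replace (S n) with (2 * S r)%nat by lia; apply bern_tail_even_0; lia).
      rewrite h0 in h. replace (S n / 2)%nat with (S (n / 2)).
      2:{ assert (e1 : (n / 2 = r)%nat) by (symmetry; apply (Nat.div_unique _ _ _ 1); lia).
          assert (e2 : (S n / 2 = S r)%nat) by (symmetry; apply (Nat.div_unique _ _ _ 0); lia).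
          lia. }
      replace (n / 2)%nat with r by (apply (Nat.div_unique _ _ _ 1); lia).
      rewrite sum_1_S. replace (2 * S r - 1)%nat with n by lia.
      assert (hs : (-1) ^ n = -1).
      { rewrite hr, pow_add, pow_mult. replace ((-1) ^ 2) with 1 by ring.
        rewrite pow1. ring. }
      change ((-1) ^ S n) with (-1 * (-1) ^ n). rewrite hs.
      set (q := (-1) ^ S r * T (2 * S r) p) in *.
      replace J with (q * g n (IZR b) - q * g n (IZR c) - J') by lra. ring.
Qed.

(** * One-sided derivatives *)

Lemma is_derive_on_eps (D : R -> Prop) (g : R -> R) (x l : R) (eps : posreal) :
  is_derive_on D g x l -> exists d : posreal, forall y,
    Rabs (y - x) < d -> y <> x -> D y -> Rabs ((g y - g x) / (y - x) - l) < eps.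
Proof.
  intros h. destruct (proj1 (filterlim_locally _ _) h eps) as [d hd].
  exists d. intros y h1 h2 h3. exact (hd y h1 h2 h3).
Qed.

(** Near x the difference quotient is within 1 of l, so |g y - g x| <= (|l| + 1) |y - x|. *)
Lemma is_derive_on_continuous (D : R -> Prop) (g : R -> R) (x l : R) :
  is_derive_on D g x l -> filterlim g (within D (locally x)) (locally (g x)).
Proof.
  intros h. destruct (is_derive_on_eps D g x l (mkposreal 1 Rlt_0_1) h) as [d hd].
  simpl in hd. apply filterlim_locally. intros eps.
  assert (hl : 0 < Rabs l + 1) by (pose proof (Rabs_pos l); lra).
  assert (hm : 0 < Rmin d (eps / (Rabs l + 1))).
  { apply Rmin_pos; [apply cond_pos|]. apply Rdiv_lt_0_compat; [apply cond_pos|exact hl]. }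
  exists (mkposreal _ hm). intros y hy hD. change (Rabs (y - x) < Rmin d (eps / (Rabs l + 1))) in hy.
  change (Rabs (g y - g x) < eps).
  destruct (Req_dec y x) as [->|hyx].
  - rewrite Rminus_diag, Rabs_R0. apply cond_pos.
  - assert (h1 : Rabs (y - x) < d) by (eapply Rlt_le_trans; [exact hy|apply Rmin_l]).
    assert (h2 : Rabs (y - x) < eps / (Rabs l + 1)) by (eapply Rlt_le_trans; [exact hy|apply Rmin_r]).
    specialize (hd y h1 hyx hD).
    set (q := (g y - g x) / (y - x)) in *.
    replace (g y - g x) with (q * (y - x)) by (unfold q; field; lra).
    assert (hq : Rabs q <= Rabs l + 1).
    { replace q with (l + (q - l)) by ring. eapply Rle_trans; [apply Rabs_triang|lra]. }
    rewrite Rabs_mult. apply Rle_lt_trans with ((Rabs l + 1) * Rabs (y - x)).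
    + apply Rmult_le_compat_r; [apply Rabs_pos|exact hq].
    + apply (Rmult_lt_compat_l (Rabs l + 1)) in h2; [|exact hl].
      replace ((Rabs l + 1) * (eps / (Rabs l + 1))) with (pos eps) in h2 by (field; lra).
      exact h2.
Qed.

(** [iota] returns l once limits are unique, which requires x to be an accumulation point of [A,B];
    this is where A < B enters. *)
Lemma derive_on_eq (A B : R) (g : R -> R) (x l : R) :
  A < B -> A <= x <= B -> is_derive_on (Icc A B) g x l -> derive_on (Icc A B) g x = l.
Proof.
  intros hAB hx h.
  assert (hF : ProperFilter' (within (Icc A B) (locally' x))).
  { constructor; [|typeclasses eauto].
    intros [d hd]. pose proof (cond_pos d) as hd0.
    (* A point of the punctured neighbourhood is found to the right of x, or to the left when x = B;
       the half of d keeps it strictly inside the ball. *)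
    destruct (Rlt_dec x B) as [hB|hB].
    - assert (hm : 0 < Rmin (d / 2) (B - x)) by (apply Rmin_pos; lra).
      pose proof (Rmin_l (d / 2) (B - x)). pose proof (Rmin_r (d / 2) (B - x)).
      apply (hd (x + Rmin (d / 2) (B - x))); [|lra|unfold Icc; lra].
      change (Rabs (x + Rmin (d / 2) (B - x) - x) < d). rewrite Rabs_right; lra.
    - assert (hm : 0 < Rmin (d / 2) (x - A)) by (apply Rmin_pos; lra).
      pose proof (Rmin_l (d / 2) (x - A)). pose proof (Rmin_r (d / 2) (x - A)).
      apply (hd (x - Rmin (d / 2) (x - A))); [|lra|unfold Icc; lra].
      change (Rabs (x - Rmin (d / 2) (x - A) - x) < d). rewrite Rabs_left; lra. }
  exact (@iota_filterlim_locally R_AbsRing R_CompleteNormedModule R _ hF _ l h).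
Qed.

(* Composing with clamp turns the one-sided derivatives on [A,B] into functions
   continuous on all of R that are still differentiable inside (A,B). *)
Definition clamp (A B x : R) : R := Rmax A (Rmin x B).

Lemma clamp_in (A B x : R) : A <= B -> A <= clamp A B x <= B.
Proof.
  intros h. unfold clamp. split; [apply Rmax_l|].
  apply Rmax_lub; [exact h|apply Rmin_r].
Qed.

Lemma clamp_id (A B x : R) : A <= x <= B -> clamp A B x = x.
Proof. intros h. unfold clamp. rewrite Rmin_left, Rmax_right; lra. Qed.

Lemma clamp_lipschitz (A B x y : R) : Rabs (clamp A B y - clamp A B x) <= Rabs (y - x).
Proof.
  unfold clamp, Rmax, Rmin.
  destruct (Rle_dec x B), (Rle_dec y B);
  repeat match goal with |- context [Rle_dec ?u ?v] => destruct (Rle_dec u v) end;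
  unfold Rabs;
  repeat match goal with |- context [Rcase_abs ?u] => destruct (Rcase_abs u) end; lra.
Qed.

Lemma continuity_clamp (A B : R) (g : R -> R) : A <= B ->
  continuous_on (Icc A B) g -> forall x, continuity_pt (fun y => g (clamp A B y)) x.
Proof.
  intros hAB hg x. apply continuity_pt_filterlim, filterlim_locally. intros eps.
  destruct (proj1 (filterlim_locally _ _) (hg (clamp A B x) (clamp_in A B x hAB)) eps)
    as [d hd].
  exists d. intros y hy. apply hd; [|now apply clamp_in].
  eapply Rle_lt_trans; [apply clamp_lipschitz|exact hy].
Qed.

Lemma is_derive_clamp (A B : R) (g : R -> R) (x l : R) : A < x < B ->
  is_derive_on (Icc A B) g x l -> is_derive (fun y => g (clamp A B y)) x l.
Proof.
  intros hx h. apply is_derive_Reals. intros eps heps.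
  destruct (is_derive_on_eps _ _ _ _ (mkposreal eps heps) h) as [d hd].
  assert (hm : 0 < Rmin d (Rmin (x - A) (B - x))).
  { apply Rmin_pos; [apply cond_pos|apply Rmin_pos; lra]. }
  exists (mkposreal _ hm). simpl. intros t ht hlt.
  pose proof (Rmin_l d (Rmin (x - A) (B - x))). pose proof (Rmin_r d (Rmin (x - A) (B - x))).
  pose proof (Rmin_l (x - A) (B - x)). pose proof (Rmin_r (x - A) (B - x)).
  assert (hb : A <= x + t <= B) by (apply Rabs_def2 in hlt; lra).
  rewrite !clamp_id by lra.
  replace t with (x + t - x) at 2 by ring.
  apply (hd (x + t)); [|lra|exact hb].
  replace (x + t - x) with t by ring. lra.
Qed.

Lemma Cn_on_is_derive_on (A B : R) (f : R -> R) (n k : nat) (x : R) :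
  A < B -> Cn_on n (Icc A B) f -> (k < n)%nat -> A <= x <= B ->
  is_derive_on (Icc A B) (derive_n_on (Icc A B) f k) x (derive_n_on (Icc A B) f (S k) x).
Proof.
  intros hAB [hd _] hk hx. destruct (hd k hk x hx) as [l hl].
  simpl. now rewrite (derive_on_eq A B _ x l hAB hx hl).
Qed.

Lemma Cn_on_continuous (A B : R) (f : R -> R) (n k : nat) :
  A < B -> Cn_on n (Icc A B) f -> (k <= n)%nat ->
  continuous_on (Icc A B) (derive_n_on (Icc A B) f k).
Proof.
  intros hAB hf hk. destruct (Nat.eq_dec k n) as [->|hkn]; [apply hf|].
  intros x hx. eapply is_derive_on_continuous.
  apply (Cn_on_is_derive_on A B f n k x hAB hf); [lia|exact hx].
Qed.

(** * Assembly on [a', b] *)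

Theorem theorem1 (a b : Z) (hab : (a < b)%Z) (n : nat) (hn : (1 <= n)%nat)
    (f : R -> R) (hf : Cn_on n (Icc (IZR a) (IZR b)) f)
    (m p : nat) (hm : (Z.of_nat m <= b - a)%Z)
    (a' : Z) (ha' : a' = (a + Z.of_nat m)%Z) :
  RtoC (Zsum (fun i : Z => f (IZR i)) a b) =
  Cplus
    (RtoC (Zsum (fun i : Z => f (IZR i)) a (a' - 1)
           + RInt (fun x => dirichlet_kernel p x * f x) (IZR a') (IZR b)
           + (f (IZR a') + f (IZR b)) / 2
           + sum_n_m (fun r : nat =>
               (-1) ^ r * T (2 * r) p
               * M (Icc (IZR a) (IZR b)) f (2 * r - 1) (IZR a') (IZR b))
               1 (n / 2)))
    (remainder (Icc (IZR a) (IZR b)) f n p (IZR a') (IZR b)).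
Proof.
  assert (hAB : IZR a < IZR b) by now apply IZR_lt.
  assert (ha'b : IZR a <= IZR a' <= IZR b) by (split; apply IZR_le; lia).
  set (D := Icc (IZR a) (IZR b)) in *.
  set (N := Z.to_nat (b - a')).
  assert (hb : (a' + Z.of_nat N)%Z = b) by lia.
  (* Clamping is to [a, b] rather than [a', b], which degenerates to a point when m = b - a. *)
  set (g := fun k x => derive_n_on D f k (clamp (IZR a) (IZR b) x)).
  assert (hg : forall k x, IZR a <= x <= IZR b -> g k x = derive_n_on D f k x).
  { intros k x hx. unfold g. now rewrite clamp_id. }
  assert (hgc : forall k x, (k <= n)%nat -> continuity_pt (g k) x).
  { intros k x hk. apply (continuity_clamp (IZR a) (IZR b)); [lra|].
    now apply (Cn_on_continuous _ _ f n). }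
  assert (hin : forall x, Rmin (IZR a') (IZR b) < x < Rmax (IZR a') (IZR b) ->
                IZR a <= x <= IZR b).
  { intros x. rewrite Rmin_left, Rmax_right; lra. }
  pose proof (euler_maclaurin g n p a' N hn hgc) as hE. rewrite hb in hE.
  assert (hR : remainder D f n p (IZR a') (IZR b)
    = RtoC ((-1) ^ n * RInt (fun x => bern_tail n p x * g n x) (IZR a') (IZR b))).
  { unfold remainder. rewrite RtoC_mult, RtoC_pow. f_equal.
    apply (is_RInt_unique (V := C_R_CompleteNormedModule)).
    apply (is_RInt_ext (V := C_R_NormedModule) (fun x => RtoC (bern_tail n p x * g n x))).
    - intros x hx. rewrite fourier_tail_eq, hg, RtoC_mult by auto. reflexivity.
    - apply is_RInt_RtoC, (RInt_correct (V := R_CompleteNormedModule)).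
      rewrite <- hb. apply ex_RInt_bern_tail; [exact hn|]. intros x. now apply hgc. }
  rewrite hR, <- RtoC_plus. f_equal.
  (* The range a..b is cut after a' - 1, leaving N + 1 indices from a' to b; the first block is
     empty when m = 0. *)
  rewrite <- hb at 1.
  replace (a' + Z.of_nat N)%Z with (a' - 1 + Z.of_nat (S N))%Z by lia.
  rewrite Zsum_split by lia.
  replace (a' - 1 + Z.of_nat (S N))%Z with b by lia. rewrite Z.sub_add.
  change plus with Rplus. rewrite !Rplus_assoc. f_equal.
  rewrite (Zsum_ext _ (fun i => g 0%nat (IZR i))).
  2:{ intros i hi. symmetry. apply (hg 0%nat). split; apply IZR_le; lia. }
  rewrite hE.
  2:{ intros k x hk hx. rewrite (hg (S k)) by lra. apply is_derive_clamp; [lra|].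
      apply (Cn_on_is_derive_on _ _ f n); [exact hAB|exact hf|exact hk|lra]. }
  rewrite (RInt_ext (V := R_CompleteNormedModule) _ (fun x => dirichlet_kernel p x * f x)).
  2:{ intros x hx. now rewrite (hg 0%nat) by auto. }
  rewrite !(hg 0%nat) by lra. rewrite !Rplus_assoc. do 3 f_equal.
  apply sum_n_m_ext. intros r. unfold M. now rewrite !hg by lra.
Qed.
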